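(* For each pair of positive integers $j,k$ there is a number $m(j,k)$ such that for each integer $m\ge m(j,k)$, the fraction $m/(km+1)$ is not the sum of $j$ unit fractions, i.e. there are no positive integers $x_1,\dots,x_j$ with $\frac{m}{km+1}=\sum_{i=1}^j\frac1{x_i}$.
   Context: A unit fraction is a number $1/x$ with $x$ a positive integer; the summands need not be distinct. *)

(* Defs.v *)
From mathcomp Require Import all_boot all_order all_algebra.

Set Implicit Arguments.
Unset Strict Implicit.
Unset Printing Implicit Defensive.

Import GRing.Theory Num.Theory.
Local Open Scope ring_scope.

Definition sum_of_unit_fractions (j : nat) (q : rat) : Prop :=
  exists x : 'I_j -> nat,
    (forall i, (0 < x i)%N) /\ q = \sum_(i < j) 1 / (x i)%:R.

(* Main.v *)
Require Import Defs.
From mathcomp Require Import all_boot all_order all_algebra.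
From mathcomp Require Import lra.

(* The fractions m/(km+1) increase strictly to 1/k, whereas the sums of j unit
   fractions do not accumulate at any point from below: below every a there is
   a gap.  This follows by induction on j.  The largest of j+1 unit fractions
   with sum q > a/2 exceeds a/(2(j+1)), so it takes finitely many values 1/n,
   and for each of them q - 1/n is subject to the gap below a - 1/n. *)

Import Order.TTheory GRing.Theory Num.Theory.
Local Open Scope ring_scope.

(** Take for [n] the smallest denominator: each of the [j.+1] terms is then at most [1 / n], and
    dropping one such term leaves [j] of them. *)
Lemma sum_of_unit_fractionsS (j : nat) (q : rat) :
  sum_of_unit_fractions j.+1 q ->
  exists n : nat, [/\ (0 < n)%N, q <= j.+1%:R / n%:R &
    sum_of_unit_fractions j (q - 1 / n%:R)].
Proof.
move=> [x [x_gt0 ->]].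
have [i _ i_min] := @arg_minnP _ ord0 xpredT x isT.
exists (x i); split=> //.
- rewrite -[j.+1 in leRHS]card_ord mulr_natl -sumr_const.
  apply: ler_sum => t _; rewrite mul1r lef_pV2 ?posrE ?ltr0n //.
  by rewrite ler_nat i_min.
- exists (fun t => x (lift i t)); split=> [t|]; first exact: x_gt0.
  by rewrite (bigD1_ord i) //= addrAC subrr add0r.
Qed.

Definition gap_below (S : rat -> Prop) (a e : rat) : Prop :=
  forall q, S q -> q < a -> q <= a - e.

(** Shrinking a gap keeps it a gap, so the minimum of finitely many works. *)
Lemma uniform_gap_below (S : rat -> Prop) (b : nat -> rat) (N : nat) :
  (forall a, exists2 e, 0 < e & gap_below S a e) ->
  exists2 e, 0 < e & forall n, (n < N)%N -> gap_below S (b n) e.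
Proof.
move=> gapS; elim: N => [|N [e e_gt0 He]]; first by exists 1.
have [d d_gt0 Hd] := gapS (b N).
exists (Num.min e d); first by rewrite lt_min e_gt0.
move=> n; rewrite ltnS leq_eqVlt => /predU1P[->|ltnN] q Sq ltqb.
- by apply: le_trans (Hd q Sq ltqb) _; rewrite lerB // ge_min lexx orbT.
- by apply: le_trans (He n ltnN q Sq ltqb) _; rewrite lerB // ge_min lexx.
Qed.

Lemma sum_of_unit_fractions_gap (j : nat) (a : rat) :
  exists2 e, 0 < e & gap_below (sum_of_unit_fractions j) a e.
Proof.
elim: j a => [|j IHj] a.
  (* The only empty sum is 0, at distance [a] below [a] if [a] is positive. *)
  have [a_gt0|a_le0] := ltP 0 a.
    by exists a => // q [x [_ ->]] _; rewrite big_ord0 subrr.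
  by exists 1 => // q [x [_ ->]]; rewrite big_ord0 ltNge a_le0.
have [a_gt0|a_le0] := ltP 0 a; last first.
  exists 1 => // q [x [_ ->]] /lt_le_trans/(_ a_le0).
  by rewrite ltNge sumr_ge0 // => i _; rewrite divr_ge0.
(* If [a / 2 < q <= j.+1 / n], then [n < c]. *)
pose c : rat := j.+1%:R / (a / 2).
have [e e_gt0 He] :=
  uniform_gap_below _ (fun n => a - 1 / n%:R) (Num.bound c) IHj.
exists (Num.min e (a / 2)); first by rewrite lt_min e_gt0 divr_gt0.
move=> q /sum_of_unit_fractionsS[n [n_gt0 le_q Sq]] lt_qa.
have [q_le|q_gt] := leP q (a / 2).
  have : Num.min e (a / 2) <= a / 2 by rewrite ge_min lexx orbT.
  lra.
have n_lt : (n < Num.bound c)%N.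
  rewrite -(ltr_nat rat); apply: lt_trans (archi_boundP _); last first.
    by rewrite divr_ge0 // divr_ge0 // ltW.
  rewrite ltr_pdivlMr ?divr_gt0 // mulrC -ltr_pdivlMr ?ltr0n //.
  exact: lt_le_trans q_gt le_q.
(* Subtracting [1 / n] from both [q] and [a] preserves their distance. *)
have := He n n_lt _ Sq; rewrite ltrD2r => /(_ lt_qa).
have : Num.min e (a / 2) <= e by rewrite ge_min lexx.
lra.
Qed.

Theorem theorem1p4 (j k : nat) (hj : (0 < j)%N) (hk : (0 < k)%N) :
  exists m0 : nat, forall m : nat, (m0 <= m)%N ->
    ~ sum_of_unit_fractions j (m%:R / (k * m + 1)%:R).
Proof.
have [e e_gt0 He] := sum_of_unit_fractions_gap j (1 / k%:R).
(* The fraction lies below [1 / k] by [1 / (k * (k * m + 1))], which is less than [e] once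
   [m > 1 / e], since [k * (k * m + 1) >= m]. *)
exists (Num.bound e^-1) => m le_m /He.
have k_gt0 : 0 < k%:R :> rat by rewrite ltr0n.
have d_gt0 : 0 < (k * m + 1)%:R :> rat by rewrite ltr0n addn1.
have -> : m%:R / (k * m + 1)%:R = 1 / k%:R - (k%:R * (k * m + 1)%:R)^-1 :> rat.
  apply: (mulIf (lt0r_neq0 d_gt0)); rewrite divfK ?lt0r_neq0 // mulrBl.
  rewrite invfM mulfVK ?lt0r_neq0 // mul1r natrD natrM mulrDr mulr1 addrK.
  by rewrite mulKf ?lt0r_neq0.
rewrite gtrBl invr_gt0 mulr_gt0 // => /(_ isT).
rewrite lerD2l lerN2 leNgt => /negP; apply.
rewrite invf_plt ?posrE ?mulr_gt0 //.
have inve_ge0 : 0 <= e^-1 by rewrite invr_ge0 ltW.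
apply: lt_le_trans (archi_boundP inve_ge0) _.
rewrite -natrM ler_nat (leq_trans le_m) // (leq_trans (leq_pmull m hk)) //.
by rewrite (leq_trans (leq_addr 1 _)) // leq_pmull.
Qed.
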